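(* Let $P\subset\mathbb{R}^n$ be a polytope with vertices $p_1,\dots,p_v$ and the origin in its interior, let $Q\subset\mathbb{R}^n$ be a polyhedron with facet inequalities $\langle h_i,x\rangle\le 1$, $i=1,\dots,f$, such that $P\subseteq Q$, and let $S_{P,Q}$ be the slack matrix of the pair $P,Q$. Let $K\subset\mathbb{R}^m$ be a closed convex cone, let $A$ be a nonnegative $K^*$-map from $\mathbb{R}^f$ to $\mathbb{R}^m$ and let $B$ be a nonnegative $K$-map from $\mathbb{R}^v$ to $\mathbb{R}^m$. Let $\Delta:=S_{P,Q}-A^*\circ B$ be the factorization error. Then: 1. $\frac{1}{1+\varepsilon}P\subseteq\mathrm{Inn}_Q(A)\subseteq Q$ for $\varepsilon=\|\Delta\|_{1,2}$; 2. $P\subseteq\mathrm{Out}_P(B)\subseteq(1+\varepsilon)Q$ for $\varepsilon=\|\Delta\|_{2,\infty}$, where $\|\Delta\|_{1,2}$ is the maximum Euclidean norm of a column of $\Delta$ and $\|\Delta\|_{2,\infty}$ is the maximum Euclidean norm of a row of $\Delta$.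
   Context: Dual spaces are identified with the spaces themselves via the standard inner product; $\|\cdot\|$ is the Euclidean norm and $\mathbb{1}$ is the all-ones vector. $S_{P,Q}$ is the $f\times v$ matrix with $(i,j)$-entry $1-\langle h_i,p_j\rangle$. Put $V_P=[p_1\ \cdots\ p_v]$ ($n\times v$) and $H_Q=[h_1\ \cdots\ h_f]$ ($n\times f$), $H_Q^*(x)=H_Q^Tx$. $K^*=\{y : \langle y,x\rangle\ge 0\ \forall x\in K\}$ is the dual cone. A nonnegative $K$-map $B:\mathbb{R}^v\to\mathbb{R}^m$ is a linear map with $B(\mathbb{R}^v_+)\subseteq K$; a nonnegative $K^*$-map $A:\mathbb{R}^f\to\mathbb{R}^m$ satisfies $A(\mathbb{R}^f_+)\subseteq K^*$. $A^*$ is the adjoint (transpose) of $A$. Cones: $\mathcal{O}_{in}^k=\{x\in\mathbb{R}^k : \sqrt{k-1}\,\|x\|\le \mathbb{1}^Tx\}$ and $\mathcal{O}_{out}^k=\{x\in\mathbb{R}^k : \|x\|\le \mathbb{1}^Tx\}$. Definitions: $\mathrm{Inn}_Q(A)=\{x\in\mathbb{R}^n : \exists y\in K,\ \mathbb{1}-H_Q^*(x)-A^*(y)\in\mathcal{O}_{in}^f\}$, $\mathrm{Out}_P(B)=\{V_P(z) : z\in\mathcal{O}_{out}^v,\ \mathbb{1}^Tz\le 1,\ B(z)\in K\}$. *)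

(* Defs.v *)
From HB Require Import structures.
From mathcomp Require Import all_boot all_order all_algebra.
From mathcomp Require Import all_classical all_reals all_analysis.

Set Implicit Arguments.
Unset Strict Implicit.
Unset Printing Implicit Defensive.

Import Order.TTheory GRing.Theory Num.Theory.
Import numFieldNormedType.Exports.

Local Open Scope classical_set_scope.
Local Open Scope ring_scope.

Definition dotp (R : realType) (k : nat) (x y : 'cV[R]_k) : R :=
  \sum_(i < k) x i 0 * y i 0.

(* [`|x|] on matrices is the sup norm in MathComp-Analysis, hence this
   separate Euclidean norm; both induce the same topology. *)
Definition enorm (R : realType) (k : nat) (x : 'cV[R]_k) : R :=
  Num.sqrt (dotp x x).

Definition ones (R : realType) (k : nat) : 'cV[R]_k := const_mx 1.

Definition orthant (R : realType) (k : nat) : set 'cV[R]_k :=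
  [set x | forall i, 0 <= x i 0].

Definition scale_set (R : realType) (k : nat) (a : R) (S : set 'cV[R]_k) :
  set 'cV[R]_k := [set a *: x | x in S].

Definition conv_hull (R : realType) (n v : nat) (p : 'I_v -> 'cV[R]_n) :
    set 'cV[R]_n :=
  [set x | exists l : 'I_v -> R,
    [/\ forall j, 0 <= l j, \sum_(j < v) l j = 1
      & x = \sum_(j < v) l j *: p j]].

Definition affinely_independent (R : realType) (n r : nat)
    (x : 'I_r -> 'cV[R]_n) : Prop :=
  forall l : 'I_r -> R, \sum_(i < r) l i = 0 ->
    \sum_(i < r) l i *: x i = 0 -> forall i, l i = 0.

(* [has_affine_rank S r] says that S has affine dimension r - 1
   (so the empty set has dimension -1). *)
Definition has_affine_rank (R : realType) (n : nat) (S : set 'cV[R]_n)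
    (r : nat) : Prop :=
  (exists x : 'I_r -> 'cV[R]_n,
     (forall i, S (x i)) /\ affinely_independent x) /\
  (forall (s : nat) (x : 'I_s -> 'cV[R]_n),
     (forall i, S (x i)) -> affinely_independent x -> (s <= r)%N).

Definition is_face (R : realType) (n : nat) (S F : set 'cV[R]_n) : Prop :=
  exists (c : 'cV[R]_n) (d : R),
    (forall x, S x -> dotp c x <= d) /\ F = [set x | S x /\ dotp c x = d].

Definition is_vertex (R : realType) (n : nat) (S : set 'cV[R]_n)
    (x : 'cV[R]_n) : Prop := is_face S [set x].

Definition is_facet (R : realType) (n : nat) (S F : set 'cV[R]_n) : Prop :=
  is_face S F /\ exists r, has_affine_rank S r.+1 /\ has_affine_rank F r.

Definition polytope_with_vertices (R : realType) (n v : nat)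
    (p : 'I_v -> 'cV[R]_n) (P : set 'cV[R]_n) : Prop :=
  [/\ P = conv_hull p, injective p & [set x | is_vertex P x] = range p].

Definition facet_of_ineq (R : realType) (n : nat) (Q : set 'cV[R]_n)
    (c : 'cV[R]_n) : set 'cV[R]_n := [set x | Q x /\ dotp c x = 1].

Definition polyhedron_with_facets (R : realType) (n f : nat)
    (h : 'I_f -> 'cV[R]_n) (Q : set 'cV[R]_n) : Prop :=
  [/\ Q = [set x | forall i, dotp (h i) x <= 1],
      injective (fun i => facet_of_ineq Q (h i))
    & [set F | is_facet Q F] = range (fun i => facet_of_ineq Q (h i))].

Definition slack_matrix (R : realType) (n v f : nat)
    (p : 'I_v -> 'cV[R]_n) (h : 'I_f -> 'cV[R]_n) : 'M[R]_(f, v) :=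
  \matrix_(i < f, j < v) (1 - dotp (h i) (p j)).

(* The matrix with columns q_1, ..., q_k: V_P for q = p, H_Q for q = h. *)
Definition cols_mx (R : realType) (n k : nat) (q : 'I_k -> 'cV[R]_n) :
  'M[R]_(n, k) := \matrix_(i < n, j < k) q j i 0.

Definition closed_convex_cone (R : realType) (m : nat) (K : set 'cV[R]_m) :
    Prop :=
  [/\ closed K, convex_set K, K !=set0
    & forall (t : R) x, 0 <= t -> K x -> K (t *: x)].

Definition dual_cone (R : realType) (m : nat) (K : set 'cV[R]_m) :
  set 'cV[R]_m := [set y | forall x, K x -> 0 <= dotp y x].

(* Linear maps R^k -> R^m are m x k matrices acting on column vectors; the
   adjoint is then the transpose. *)
Definition nonneg_map (R : realType) (m k : nat) (K : set 'cV[R]_m)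
    (M : 'M[R]_(m, k)) : Prop :=
  [set M *m z | z in @orthant R k] `<=` K.

(* For k = 0, [Num.sqrt (-1) = 0] and the cone is the whole space {0}. *)
Definition O_in (R : realType) (k : nat) : set 'cV[R]_k :=
  [set x | Num.sqrt (k%:R - 1) * enorm x <= dotp (ones R k) x].

Definition O_out (R : realType) (k : nat) : set 'cV[R]_k :=
  [set x | enorm x <= dotp (ones R k) x].

Definition Inn (R : realType) (n f m : nat) (h : 'I_f -> 'cV[R]_n)
    (K : set 'cV[R]_m) (A : 'M[R]_(m, f)) : set 'cV[R]_n :=
  [set x | exists2 y, K y &
    O_in (ones R f - (cols_mx h)^T *m x - A^T *m y)].

Definition Out (R : realType) (n v m : nat) (p : 'I_v -> 'cV[R]_n)
    (K : set 'cV[R]_m) (B : 'M[R]_(m, v)) : set 'cV[R]_n :=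
  [set cols_mx p *m z | z in
    [set z | [/\ O_out z, dotp (ones R v) z <= 1 & K (B *m z)]]].

(* The default value 0 of the maxima is harmless since norms are nonnegative. *)
Definition norm_1_2 (R : realType) (f v : nat) (D : 'M[R]_(f, v)) : R :=
  \big[Num.max/0]_(j < v) enorm (col j D).

Definition norm_2_inf (R : realType) (f v : nat) (D : 'M[R]_(f, v)) : R :=
  \big[Num.max/0]_(i < f) enorm (row i D)^T.

(* Main.v *)
Require Import Defs.
From HB Require Import structures.
From mathcomp Require Import all_boot all_order all_algebra.
From mathcomp Require Import all_classical all_reals all_analysis.
From mathcomp Require Import ring lra.
Import Order.TTheory GRing.Theory Num.Theory.
Import numFieldNormedType.Exports.
Local Open Scope classical_set_scope.
Local Open Scope ring_scope.
Set Implicit Arguments.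
Unset Strict Implicit.

(** The slack matrix satisfies [S l = ones - H^T (V l)] as soon as the entries
    of [l] sum to 1, so [H^T (V l) = ones - A^T (B l) - Delta l].  Hence for
    [x = V l] in [P] the witness [y = B l / (1 + eps)] turns the vector that has
    to lie in [O_in] for [x / (1 + eps)] into a positive multiple of
    [eps *: ones + Delta l]; and [O_in] is the cone spanned by the unit ball
    around [ones], which is inscribed in the orthant.  For [z] in [O_out],
    Cauchy-Schwarz gives [- (Delta z)_i <= eps * enorm z <= eps * dotp ones z].
    The remaining two inclusions are [O_in <= orthant <= O_out]. *)

Lemma dotpE (R : realType) (k : nat) (x y : 'cV[R]_k) :
  dotp x y = (x^T *m y) 0 0.
Proof. by rewrite mxE; apply: eq_bigr => i _; rewrite mxE. Qed.

Lemma dotpC (R : realType) (k : nat) (x y : 'cV[R]_k) : dotp x y = dotp y x.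
Proof. by apply: eq_bigr => i _; rewrite mulrC. Qed.

Lemma dotpDr (R : realType) (k : nat) (x y z : 'cV[R]_k) :
  dotp x (y + z) = dotp x y + dotp x z.
Proof. by rewrite !dotpE mulmxDr mxE. Qed.

Lemma dotpZr (R : realType) (k : nat) (a : R) (x y : 'cV[R]_k) :
  dotp x (a *: y) = a * dotp x y.
Proof. by rewrite !dotpE -scalemxAr mxE. Qed.

Lemma dotpDl (R : realType) (k : nat) (x y z : 'cV[R]_k) :
  dotp (x + y) z = dotp x z + dotp y z.
Proof. by rewrite dotpC dotpDr !(dotpC z). Qed.

Lemma dotpZl (R : realType) (k : nat) (a : R) (x y : 'cV[R]_k) :
  dotp (a *: x) y = a * dotp x y.
Proof. by rewrite dotpC dotpZr dotpC. Qed.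

Lemma dotp_trmul (R : realType) (k l : nat) (M : 'M[R]_(l, k)) x y :
  dotp (M^T *m x) y = dotp x (M *m y).
Proof. by rewrite !dotpE trmx_mul trmxK mulmxA. Qed.

Lemma dotp_delta (R : realType) (k : nat) (x : 'cV[R]_k) i :
  dotp x (delta_mx i 0) = x i 0.
Proof. by rewrite dotpE -colE !mxE. Qed.

Lemma dotp_ge0 (R : realType) (k : nat) (x : 'cV[R]_k) : 0 <= dotp x x.
Proof. by apply: sumr_ge0 => i _; rewrite -expr2 sqr_ge0. Qed.

Lemma dotp_eq0 (R : realType) (k : nat) (x : 'cV[R]_k) :
  dotp x x = 0 -> x = 0.
Proof.
move=> /psumr_eq0P x0; apply/matrixP => i j; rewrite ord1 mxE.
by apply/eqP; rewrite -sqrf_eq0 expr2 x0// => l _; rewrite -expr2 sqr_ge0.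
Qed.

Lemma dotp_ones (R : realType) (k : nat) (x : 'cV[R]_k) :
  dotp (ones R k) x = \sum_i x i 0.
Proof. by apply: eq_bigr => i _; rewrite mxE mul1r. Qed.

Lemma dotp_ones_ones (R : realType) (k : nat) :
  dotp (ones R k) (ones R k) = k%:R.
Proof.
rewrite dotp_ones (eq_bigr (fun=> 1)) => [|i _]; last by rewrite mxE.
by rewrite sumr_const card_ord.
Qed.

(** Cauchy-Schwarz in squared form: the square of [dotp y y *: x - dotp x y *: y] expands to
    [dotp y y] times the difference of the two sides. *)
Lemma dotp_sqr_le (R : realType) (k : nat) (x y : 'cV[R]_k) :
  dotp x y ^+ 2 <= dotp x x * dotp y y.
Proof.
have := dotp_ge0 y; rewrite le_eqVlt => /predU1P[y0|y0].
  by rewrite -y0 (@dotp_eq0 _ _ y)// -(scale0r 0) dotpZr mul0r expr0n mulr0.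
have := dotp_ge0 (dotp y y *: x + - dotp x y *: y).
rewrite !(dotpDl, dotpDr, dotpZl, dotpZr) (dotpC y x).
set a := dotp x x; set b := dotp y y; set c := dotp x y => H.
rewrite -subr_ge0 -(pmulr_rge0 _ y0).
by move: H; congr (_ <= _); rewrite /b; ring.
Qed.

Lemma enorm_ge0 (R : realType) (k : nat) (x : 'cV[R]_k) : 0 <= enorm x.
Proof. exact: sqrtr_ge0. Qed.

Lemma enorm_sqr (R : realType) (k : nat) (x : 'cV[R]_k) :
  enorm x ^+ 2 = dotp x x.
Proof. by rewrite sqr_sqrtr// dotp_ge0. Qed.

Lemma cauchy_schwarz_enorm (R : realType) (k : nat) (x y : 'cV[R]_k) :
  `|dotp x y| <= enorm x * enorm y.
Proof.
rewrite -(@ler_pXn2r _ 2)// ?nnegrE ?mulr_ge0 ?enorm_ge0//.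
by rewrite real_normK ?num_real// exprMn !enorm_sqr dotp_sqr_le.
Qed.

(** After squaring, the bound holds term by term, since each coordinate is at most the sum of all of
    them. *)
Lemma orthant_sub_O_out (R : realType) (k : nat) :
  @orthant R k `<=` @O_out R k.
Proof.
move=> x x0; rewrite /O_out/= dotp_ones.
have s0 : 0 <= \sum_i x i 0 by apply: sumr_ge0 => i _; exact: x0.
rewrite -(@ler_pXn2r _ 2)// ?nnegrE ?enorm_ge0// enorm_sqr expr2 mulr_suml.
apply: ler_sum => i _; rewrite ler_wpM2l ?x0// (bigD1 i)//= lerDl.
by apply: sumr_ge0 => j _; exact: x0.
Qed.

Lemma O_in_sub_orthant (R : realType) (k : nat) :
  @O_in R k `<=` @orthant R k.
Proof.
(* The index [i] rules out [k = 0], so the square root in [O_in] is a genuine one. *)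
move=> x /= xin i; have k1 : 0 <= k%:R - 1 :> R.
  by rewrite subr_ge0 ler1n; case: k {x xin} i => // -[].
have s0 : 0 <= dotp (ones R k) x.
  by apply: le_trans xin; rewrite mulr_ge0 ?sqrtr_ge0 ?enorm_ge0.
move: xin; rewrite /O_in/= -(@ler_pXn2r _ 2)// ?nnegrE//; last first.
  by rewrite mulr_ge0 ?sqrtr_ge0 ?enorm_ge0.
rewrite exprMn sqr_sqrtr// enorm_sqr.
(* Cauchy-Schwarz for the coordinates other than [i] *)
pose e : 'cV[R]_k := delta_mx i 0.
have := dotp_sqr_le (ones R k + -1 *: e) (x + - x i 0 *: e).
rewrite !(dotpDl, dotpDr, dotpZl, dotpZr) !(dotpC e) !dotp_delta dotp_ones_ones.
rewrite !mxE !eqxx /=.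
move: (dotp (ones R k) x) (dotp x x) (x i 0) s0 => s d t s0 h1 h2.
(* Here [h2] amounts to [(s - t)^2 <= (k - 1) (d - t^2)]; with [(k - 1) d <= s^2] from [h1] it gives
   [k t^2 <= 2 s t], impossible for [t < 0 <= s]. *)
by rewrite leNgt; apply/negP => t0; nra.
Qed.

Lemma O_in_scale (R : realType) (k : nat) (a : R) (x : 'cV[R]_k) :
  0 <= a -> O_in x -> O_in (a *: x).
Proof.
move=> a0; rewrite /O_in/= /enorm !(dotpZr, dotpZl) mulrA -expr2.
rewrite sqrtrM ?sqr_ge0// sqrtr_sqr ger0_norm// mulrCA => xin.
exact: ler_wpM2l.
Qed.

(** In dimension [k.+1], with [s] the coordinate sum of [d], the squared sides differ by
    [(r + s)^2 + k (r^2 - dotp d d)], which is nonnegative. *)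
Lemma O_in_ball (R : realType) (k : nat) (r : R) (d : 'cV[R]_k) :
  enorm d <= r -> O_in (r *: ones R k + d).
Proof.
(* Dimension 0 is split off because [k%:R - 1] is negative there; both sides are then 0. *)
case: k d => [|k] d dr.
  by rewrite flatmx0 /O_in/= /enorm /dotp !big_ord0 sqrtr0 mulr0.
have r0 : 0 <= r := le_trans (enorm_ge0 d) dr.
have dd : dotp d d <= r ^+ 2.
  by rewrite -enorm_sqr ler_pXn2r ?nnegrE ?enorm_ge0.
have := dotp_sqr_le (ones R k.+1) d.
rewrite /O_in/= dotpDr dotpZr dotp_ones_ones => cs.
have k0 : 0 <= k%:R :> R by [].
have kE : k.+1%:R = k%:R + 1 :> R by rewrite natr1.
(* Squaring needs this sign; it holds because the square of the coordinate sum of [d] is at most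
   [k.+1 * r^2], hence at most [(r * k.+1)^2]. *)
have s0 : 0 <= r * k.+1%:R + dotp (ones R k.+1) d.
  rewrite -lerBlDl sub0r lerNl; apply: le_trans (ler_norm _) _.
  rewrite normrN -(@ler_pXn2r _ 2)// ?nnegrE ?mulr_ge0//.
  rewrite real_normK ?num_real//; apply: le_trans cs _.
  rewrite exprMn mulrC ler_pM ?dotp_ge0//.
  by rewrite expr2 ler_peMl// ler1n.
rewrite -(@ler_pXn2r _ 2)// ?nnegrE ?mulr_ge0 ?sqrtr_ge0 ?enorm_ge0//.
rewrite exprMn enorm_sqr sqr_sqrtr; last by rewrite kE addrK.
rewrite !(dotpDl, dotpDr, dotpZl, dotpZr) (dotpC d (ones _ _)) dotp_ones_ones.
rewrite kE addrK.
set s := dotp (ones _ _) d; rewrite -subr_ge0.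
rewrite [X in 0 <= X](_ : _ =
  (r + s) ^+ 2 + k%:R * (r ^+ 2 - dotp d d)); last by ring.
by rewrite addr_ge0 ?sqr_ge0// mulr_ge0 ?subr_ge0.
Qed.

(** The coordinate is the pairing of [y] in [K] with the image under [A] of a basis vector, which
    lies in the dual cone. *)
Lemma trmx_dual_ge0 (R : realType) (m k : nat) (K : set 'cV[R]_m)
    (A : 'M[R]_(m, k)) (y : 'cV[R]_m) i :
  nonneg_map (dual_cone K) A -> K y -> 0 <= (A^T *m y) i 0.
Proof.
move=> hA Ky; rewrite -dotp_delta dotp_trmul dotpC; apply: hA Ky.
by exists (delta_mx i 0) => // j; rewrite mxE.
Qed.

Lemma slack_matrixE (R : realType) (n v f : nat)
    (p : 'I_v -> 'cV[R]_n) (h : 'I_f -> 'cV[R]_n) :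
  slack_matrix p h = ones R f *m (ones R v)^T - (cols_mx h)^T *m cols_mx p.
Proof.
apply/matrixP => i j; rewrite !mxE big_ord1 !mxE mulr1; congr (_ - _).
by apply: eq_bigr => l _; rewrite !mxE.
Qed.

Lemma slack_matrix_mul (R : realType) (n v f : nat)
    (p : 'I_v -> 'cV[R]_n) (h : 'I_f -> 'cV[R]_n) (z : 'cV[R]_v) :
  slack_matrix p h *m z =
  dotp (ones R v) z *: ones R f - (cols_mx h)^T *m (cols_mx p *m z).
Proof.
rewrite slack_matrixE mulmxBl -!mulmxA; congr (_ - _).
by apply/matrixP => i j; rewrite ord1 dotpE !mxE big_ord1 !mxE mul1r mulr1.
Qed.

Lemma cols_mx_mul (R : realType) (n k : nat) (q : 'I_k -> 'cV[R]_n) z :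
  cols_mx q *m z = \sum_j z j 0 *: q j.
Proof.
apply/matrixP => i j; rewrite ord1 mxE summxE; apply: eq_bigr => l _.
by rewrite !mxE mulrC.
Qed.

Lemma tr_cols_mx_mul (R : realType) (n k : nat) (q : 'I_k -> 'cV[R]_n) x i :
  ((cols_mx q)^T *m x) i 0 = dotp (q i) x.
Proof. by rewrite mxE; apply: eq_bigr => l _; rewrite !mxE. Qed.

(** Gathering the convex weights into a vector presents [P], like [Out], as an image under
    [cols_mx p]. *)
Lemma conv_hullE (R : realType) (n v : nat) (p : 'I_v -> 'cV[R]_n) :
  conv_hull p = [set cols_mx p *m z | z in
    [set z | orthant z /\ dotp (ones R v) z = 1]].
Proof.
apply/seteqP; split=> [x [l [l0 l1 ->]]|x [z [z0 z1] <-]].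
  exists (\col_j l j); last first.
    by rewrite cols_mx_mul; apply: eq_bigr => j _; rewrite mxE.
  split=> [j|]; first by rewrite mxE.
  by rewrite dotp_ones -l1; apply: eq_bigr => j _; rewrite mxE.
by exists (fun j => z j 0); split; rewrite -?dotp_ones -?cols_mx_mul.
Qed.

Lemma norm_1_2_ge0 (R : realType) (f v : nat) (D : 'M[R]_(f, v)) :
  0 <= norm_1_2 D.
Proof. exact: bigmax_ge_id. Qed.

Lemma norm_2_inf_ge0 (R : realType) (f v : nat) (D : 'M[R]_(f, v)) :
  0 <= norm_2_inf D.
Proof. exact: bigmax_ge_id. Qed.

(** Pairing [D *m z] with itself gives a sum of [z j 0] times its pairing with column [j];
    Cauchy-Schwarz bounds each term, and one factor [enorm (D *m z)] cancels when nonzero. *)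
Lemma enorm_mul_le (R : realType) (f v : nat) (D : 'M[R]_(f, v)) z :
  orthant z -> enorm (D *m z) <= norm_1_2 D * dotp (ones R v) z.
Proof.
move=> z0; have s0 : 0 <= dotp (ones R v) z.
  by rewrite dotp_ones; apply: sumr_ge0 => j _; exact: z0.
have := enorm_ge0 (D *m z); rewrite le_eqVlt => /predU1P[<-|d0].
  by rewrite mulr_ge0 ?norm_1_2_ge0.
rewrite -(ler_pM2l d0) -expr2 enorm_sqr -[dotp _ _]dotp_trmul dotp_ones !mulr_sumr.
apply: ler_sum => j _; rewrite mulrA ler_wpM2r ?z0//.
have -> : (D^T *m (D *m z)) j 0 = dotp (D *m z) (col j D).
  by rewrite colE -dotp_trmul dotp_delta.
apply: le_trans (ler_norm _) _; apply: le_trans (cauchy_schwarz_enorm _ _) _.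
by rewrite ler_wpM2l ?enorm_ge0// le_bigmax.
Qed.

Lemma mulmx_coord_le (R : realType) (f v : nat) (D : 'M[R]_(f, v)) z i :
  `|(D *m z) i 0| <= norm_2_inf D * enorm z.
Proof.
have -> : (D *m z) i 0 = dotp (row i D)^T z.
  by rewrite dotpE trmxK -row_mul [RHS]mxE.
apply: le_trans (cauchy_schwarz_enorm _ _) _.
rewrite ler_wpM2r ?enorm_ge0//.
exact: (le_bigmax 0 (fun i => enorm (row i D)^T)).
Qed.

Unset Implicit Arguments.

Theorem proposition4p3 (R : realType) (n v f m : nat)
    (p : 'I_v -> 'cV[R]_n) (h : 'I_f -> 'cV[R]_n)
    (P Q : set 'cV[R]_n) (K : set 'cV[R]_m)
    (A : 'M[R]_(m, f)) (B : 'M[R]_(m, v))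
    (hP : polytope_with_vertices p P)
    (h0 : interior P 0)
    (hQ : polyhedron_with_facets h Q)
    (hPQ : P `<=` Q)
    (hK : closed_convex_cone K)
    (hA : nonneg_map (dual_cone K) A)
    (hB : nonneg_map K B) :
  let Delta := slack_matrix p h - A^T *m B in
  (let eps := norm_1_2 Delta in
     scale_set (1 / (1 + eps)) P `<=` Inn h K A /\ Inn h K A `<=` Q) /\
  (let eps := norm_2_inf Delta in
     P `<=` Out p K B /\ Out p K B `<=` scale_set (1 + eps) Q).
Proof.
have -> : P = conv_hull p by case: hP.
have QE : Q = [set x | forall i, dotp (h i) x <= 1] by case: hQ.
have [_ _ _ KZ] := hK.
move=> Delta.
(* The coordinate sum of [z] stays arbitrary: it is 1 on [P] but only at most 1 on [Out]. *)
have HV z : (cols_mx h)^T *m (cols_mx p *m z) =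
    dotp (ones R v) z *: ones R f - A^T *m (B *m z) - Delta *m z.
  by rewrite mulmxBl slack_matrix_mul -mulmxA opprB addrA subrK subKr.
have KB z : orthant z -> K (B *m z) by move=> z0; apply: hB; exists z.
rewrite conv_hullE QE; split=> eps; split.
- have e0 : 0 < 1 + eps by rewrite ltr_wpDr ?norm_1_2_ge0.
  have e0' : 0 <= (1 + eps)^-1 by rewrite invr_ge0 ltW.
  move=> _ [_ [z [z0 z1] <-] <-]; exists ((1 + eps)^-1 *: (B *m z)).
    exact/KZ/KB.
  suff -> : ones R f - (cols_mx h)^T *m (1 / (1 + eps) *: (cols_mx p *m z))
      - A^T *m ((1 + eps)^-1 *: (B *m z)) =
      (1 + eps)^-1 *: (eps *: ones R f + Delta *m z).
    apply/O_in_scale/O_in_ball => //.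
    by have := enorm_mul_le Delta z0; rewrite z1 mulr1.
  rewrite -!scalemxAr HV z1 scale1r div1r.
  (* Multiplying by [1 + eps] clears the inverses; the [A^T] terms then cancel. *)
  apply: (scalerI (lt0r_neq0 e0)).
  rewrite !scalerBr !scalerA divff ?lt0r_neq0// !scale1r.
  move: (A^T *m _) (Delta *m z) => a d.
  by apply/matrixP => i j; rewrite !mxE; ring.
(* Coordinate [i] reads [1 - dotp (h i) x - (A^T *m y) i 0 >= 0], and the subtracted [A^T] term is
   nonnegative. *)
- move=> x [y Ky /O_in_sub_orthant xin] i /=.
  move: (xin i) (trmx_dual_ge0 i hA Ky).
  rewrite -tr_cols_mx_mul; move: (_ *m x) (_ *m y) => a b.
  by rewrite !mxE; lra.
- move=> _ [z [z0 z1] <-]; exists z => //; split; last exact: KB.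
    exact: orthant_sub_O_out.
  by rewrite z1.
- have e0 : 0 < 1 + eps by rewrite ltr_wpDr ?norm_2_inf_ge0.
  move=> _ [z [zout z1 Kz] <-]; exists ((1 + eps)^-1 *: (cols_mx p *m z)).
    move=> i; rewrite dotpZr ler_pdivrMl// mulr1 -tr_cols_mx_mul HV.
    have hD : `|(Delta *m z) i 0| <= eps * enorm z := mulmx_coord_le Delta z i.
    have hAB := trmx_dual_ge0 i hA Kz.
    (* On [Out], [enorm z] is at most the coordinate sum of [z], hence at most 1. *)
    have hz : eps * enorm z <= eps.
      by rewrite ler_piMr ?norm_2_inf_ge0// (le_trans zout).
    have hN := ler_norm (- (Delta *m z) i 0); rewrite normrN in hN.
    move: hD hAB hN; move: (A^T *m _) (Delta *m z) => a d.
    by rewrite !mxE; lra.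
  by rewrite scalerA divff ?lt0r_neq0// scale1r.
Qed.
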